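(* There is a universal constant $C>0$ such that for all $q>2$, integers $n,p\ge1$ and $\sigma,B>0$, \[ \mathcal{E}_q(\sigma,B)\le C\min\{B,\,U^*(q,\sigma,B,p,n)\}, \] where \[ U^*(q,\sigma,B,p,n)=\begin{cases}\sigma\sqrt{\dfrac{\ln(2p)}n}, & \text{if } (B^2/\sigma^2)^{q/(q-2)}(\ln(2p)/n)\le e,\\[2ex] B\Big(\dfrac{\ln(2p)}n\Big)^{1-1/q}\Big[\ln\Big(\dfrac{B^2}{\sigma^2}\Big(\dfrac{\ln(2p)}n\Big)^{1-2/q}\Big)\Big]^{1/q-1}, & \text{if } (B^2/\sigma^2)^{q/(q-2)}(\ln(2p)/n)>e.\end{cases} \]
   Context: For independent mean-zero random vectors $\boldsymbol{X}_1,\dots,\boldsymbol{X}_n$ in $\mathbb{R}^p$ with joint law $P^n$, set $\mathcal{V}(P^n)=\max_{1\le j\le p}\frac1n\sum_{i=1}^n\mathbb{E}[X_i(j)^2]$ and $\mathcal{D}_q(P^n)=(\frac1n\sum_{i=1}^n\mathbb{E}[\max_{1\le j\le p}|X_i(j)|^q])^{1/q}$. $\mathcal{E}_q(\sigma,B)$ is the supremum of $\mathbb{E}[\max_{1\le j\le p}|\frac1n\sum_{i=1}^nX_i(j)|]$ over all such laws with $\mathcal{V}(P^n)\le\sigma^2$ and $\mathcal{D}_q(P^n)\le B$. The constant $C$ does not depend on $n,p,q,\sigma,B$. *)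

(* Defs.v *)
From HB Require Import structures.
From mathcomp Require Import all_boot all_order all_algebra.
From mathcomp Require Import all_classical all_reals all_analysis.
Set Implicit Arguments. Unset Strict Implicit. Unset Printing Implicit Defensive.
Import Order.TTheory GRing.Theory Num.Theory.
Local Open Scope classical_set_scope.
Local Open Scope ring_scope.

Section Defs.
Context {R : realType} {d : measure_display} {T : measurableType d}.

(* A random vector X_i in R^p is given by its coordinates X i j : T -> R. *)

Definition gen_sigma (p : nat) (Y : 'I_p -> T -> R) : set (set T) :=
  <<s [set E | exists j A, measurable A /\ E = Y j @^-1` A] >>.

(* mutual independence of the random vectors X_1, ..., X_n
   (product rule for one event from each generated sigma-algebra;
    events may be setT, so every subfamily is covered) *)
Definition indep_vectors (P : probability T R) (n p : nat)
  (X : 'I_n -> 'I_p -> T -> R) : Prop :=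
  forall E : 'I_n -> set T, (forall i, gen_sigma (X i) (E i)) ->
    P (\bigcap_(i in [set: 'I_n]) E i) = (\prod_(i < n) P (E i))%E.

Definition Vvar (P : probability T R) (n p : nat)
  (X : 'I_n -> 'I_p -> T -> R) : \bar R :=
  (\big[Order.max/0%E]_(j < p)
     ((n%:R)^-1%:E * \sum_(i < n) \int[P]_x ((X i j x) ^+ 2)%:E))%E.

Definition Dq (P : probability T R) (q : R) (n p : nat)
  (X : 'I_n -> 'I_p -> T -> R) : \bar R :=
  poweR ((n%:R)^-1%:E *
     \sum_(i < n) \int[P]_x (powR (\big[Order.max/0]_(j < p) `|X i j x|) q)%:E)%E
    q^-1.

Definition Emax (P : probability T R) (n p : nat)
  (X : 'I_n -> 'I_p -> T -> R) : \bar R :=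
  (\int[P]_x (\big[Order.max/0]_(j < p) `|(n%:R)^-1 * \sum_(i < n) X i j x|)%:E)%E.

End Defs.

Definition Ustar {R : realType} (q sigma B : R) (p n : nat) : R :=
  let L := ln (2 * p%:R) / n%:R in
  if powR (B ^+ 2 / sigma ^+ 2) (q / (q - 2)) * L <= expR 1
  then sigma * Num.sqrt L
  else B * powR L (1 - q^-1) *
       powR (ln (B ^+ 2 / sigma ^+ 2 * powR L (1 - 2 / q))) (q^-1 - 1).

(* Main.v *)
(** Truncate each vector at the level [M] of its sup norm.  The discarded part
    costs at most [M^(1-q) B^q] per side by Markov.  For the bounded part, the
    exponential moments at a parameter [lam] are controlled by the variance
    through [e^t <= 1 + t + kap t^2], which holds for all [t <= lam M] with
    [kap] of order [e^(lam M) min (1, (lam M)^-2)], and multiply by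
    independence.  A union bound over the [2p] signed coordinates then gives
    [3 ln(2p) / (n lam) + 2 M^(1-q) B^q + kap lam sigma^2].  In the first regime
    of [Ustar] take [lam = sqrt L / sigma] and [lam M = e], where [L = ln(2p)/n];
    in the second take [lam = L / Ustar] and [lam M] equal to the logarithm that
    occurs in [Ustar]. *)
Require Import Defs.
From HB Require Import structures.
From mathcomp Require Import all_boot all_order all_algebra.
From mathcomp Require Import all_classical all_reals all_analysis.
From mathcomp Require Import measurable_realfun ring lra.
Import Order.TTheory GRing.Theory Num.Theory.
Local Open Scope classical_set_scope.
Local Open Scope ring_scope.

(** * Product rule for integrals of independent nonnegative functions *)

Section Independence.
Context {R : realType} {d : measure_display} {T : measurableType d}
  (P : probability T R).
Import HBNNSimple.

Lemma measurable_fun_g_sigma (G : set (set T)) (f : T -> R) :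
  G `<=` measurable ->
  measurable_fun (setT : set (g_sigma_algebraType G)) f ->
  measurable_fun (setT : set T) f.
Proof.
move=> sG mf _ A mA.
have := mf measurableT A mA; apply: smallest_sub => //.
exact: sigma_algebra_measurable.
Qed.

(* The integrand [F] is approximated by simple functions on the type carrying the
   sigma-algebra generated by [G], so that their level sets lie in it. *)
Lemma integral_sigma_ext (G : set (set T)) (H : T -> R) (c : R) :
  G `<=` measurable -> measurable_fun setT H -> (forall x, 0 <= H x) ->
  0 <= c -> (forall A, <<s G >> A ->
     (\int[P]_x (\1_A x * H x)%:E = P A * c%:E)%E) ->
  forall F : T -> R,
    measurable_fun (setT : set (g_sigma_algebraType G)) F ->
    (forall x, 0 <= F x) ->
    (\int[P]_x (F x * H x)%:E = (\int[P]_x (F x)%:E) * c%:E)%E.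
Proof.
move=> sG mH H0 c0 HE F mF F0.
have mEF : @measurable_fun _ _ (g_sigma_algebraType G) (\bar R)
    setT (fun x => (F x)%:E).
  exact/measurable_EFinP.
pose h := nnsfun_approx measurableT mEF.
pose E m y : set T := h m @^-1` [set y].
have sGm A : <<s G >> A -> measurable A.
  by apply: smallest_sub => //; exact: sigma_algebra_measurable.
have hm m y : <<s G >> (E m y) by exact: (@measurable_sfunP _ _ _ _ (h m) [set y]).
have mh m : measurable_fun setT (h m : T -> R).
  by apply: (@measurable_fun_g_sigma G) => //; exact: measurable_funPT.
have h0 m x : 0 <= h m x by exact: fun_ge0.
have hF x : (h m x)%:E @[m --> \oo] --> (F x)%:E.
  by apply: (cvg_nnsfun_approx measurableT mEF) => // y _; rewrite lee_fin.
have hnd m1 m2 x : (m1 <= m2)%N -> h m1 x <= h m2 x.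
  by move=> m12; apply/lefP; exact: nd_nnsfun_approx.
have simple m (K : T -> R) : measurable_fun setT K -> (forall x, 0 <= K x) ->
  (\int[P]_x (h m x * K x)%:E =
   \sum_(y \in range (h m)) (y%:E * \int[P]_x (\1_(E m y) x * K x)%:E))%E.
  move=> mK K0.
  have yind y x : 0 <= y * (\1_(E m y) x * K x).
    rewrite indicE; have [|_] := boolP (x \in E m y).
      by rewrite inE /= => <-; rewrite mul1r mulr_ge0.
    by rewrite mul0r mulr0.
  have mind y : measurable_fun setT (fun x => \1_(E m y) x * K x).
    apply: measurable_funM => //; apply: measurable_indic; exact: sGm.
  transitivity (\int[P]_x (\sum_(y \in range (h m))
     (y * (\1_(E m y) x * K x))%:E))%E.
    apply: eq_integral => x _; rewrite fsumEFin//; congr (_%:E).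
    rewrite (_ : h m x = \sum_(y \in range (h m)) (y * \1_(E m y) x));
      last exact: fimfunE.
    rewrite mulr_fsuml//.
    by apply: eq_fsbigr => y _; rewrite mulrA.
  rewrite ge0_integral_fsum//.
  - apply: eq_fsbigr => y /set_mem[x _ <-].
    under eq_integral do rewrite EFinM.
    rewrite ge0_integralZl_EFin//.
    + by move=> z _; rewrite lee_fin mulr_ge0.
    + exact/measurable_EFinP.
  - by move=> y; apply/measurable_EFinP; apply: measurable_funM.
  - by move=> y x _; rewrite lee_fin.
have cv (g : T -> R) : measurable_fun setT g -> (forall x, 0 <= g x) ->
    (\int[P]_x (h m x * g x)%:E @[m --> \oo] --> \int[P]_x (F x * g x)%:E)%E.
  move=> mg g0.
  have -> : (\int[P]_x (F x * g x)%:E =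
             \int[P]_x (limn (fun m => (h m x * g x)%:E)))%E.
    apply: eq_integral => x _; apply/esym/cvg_lim => //.
    under eq_fun do rewrite EFinM.
    by rewrite EFinM; apply: cvgeZr.
  apply: cvg_monotone_convergence => //.
  - by move=> m; apply/measurable_EFinP; exact: measurable_funM.
  - by move=> m x _; rewrite lee_fin mulr_ge0.
  - by move=> x _ m1 m2 m12; rewrite lee_fin ler_wpM2r// hnd.
have Zr (f : T -> R) : measurable_fun setT f -> (forall x, 0 <= f x) ->
    (\int[P]_x (f x * c)%:E = (\int[P]_x (f x)%:E) * c%:E)%E.
  move=> mf f0; under eq_integral do rewrite EFinM.
  rewrite ge0_integralZr//.
  - exact/measurable_EFinP.
  - by move=> x _; rewrite lee_fin.
rewrite -Zr//; last exact: measurable_fun_g_sigma mF.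
(* Each [h m] is a combination of indicators of sets in the generated sigma-algebra, where the
   hypothesis [HE] applies. The two sequences of integrals coincide, hence so do their monotone
   limits. *)
have eqm : (fun m => \int[P]_x (h m x * c)%:E)%E =
           (fun m => \int[P]_x (h m x * H x)%:E)%E.
  apply/funext => m; rewrite (simple m (cst c))// simple//.
  apply: eq_fsbigr => y _; congr (_ * _)%E.
  rewrite HE// Zr//; last by apply: measurable_indic; exact: sGm.
  by rewrite integral_indic ?setIT//; exact: sGm.
have := cv (cst c) (measurable_cst _) (fun=> c0).
rewrite /= eqm => cvc; exact: (cvg_unique _ (cv _ mH H0) cvc).
Qed.

(** Independence is the case of indicators. [integral_sigma_ext] upgrades one factor at a time to a
    nonnegative function, with the product of the other factors as weight [H]. Finite integrals make
    the product of the remaining expectations a real constant [c]. *)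
Lemma integral_prod_indep (n : nat) (G : 'I_n -> set (set T)) :
  (forall i, G i `<=` measurable) ->
  (forall E : 'I_n -> set T, (forall i, <<s G i >> (E i)) ->
    P (\bigcap_(i in [set: 'I_n]) E i) = (\prod_(i < n) P (E i))%E) ->
  forall f : 'I_n -> T -> R,
    (forall i, measurable_fun (setT : set (g_sigma_algebraType (G i))) (f i)) ->
    (forall i x, 0 <= f i x) ->
    (forall i, \int[P]_x (f i x)%:E < +oo)%E ->
    (\int[P]_x (\prod_(i < n) f i x)%:E = \prod_(i < n) \int[P]_x (f i x)%:E)%E.
Proof.
move=> sG indP.
have sGm i A : <<s G i >> A -> measurable A.
  by apply: smallest_sub => //; exact: sigma_algebra_measurable.
(* Induction on the number [k] of factors that need not be indicators. *)
suff main k : forall f : 'I_n -> T -> R,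
    (forall i, measurable_fun (setT : set (g_sigma_algebraType (G i))) (f i)) ->
    (forall i x, 0 <= f i x) ->
    (forall i, \int[P]_x (f i x)%:E < +oo)%E ->
    (forall i : 'I_n, (k <= i)%N -> exists2 A, <<s G i >> A & f i = \1_A) ->
    (\int[P]_x (\prod_(i < n) f i x)%:E = \prod_(i < n) \int[P]_x (f i x)%:E)%E.
  move=> f mf f0 fy; apply: (main n) => // i.
  by rewrite leqNgt ltn_ord.
elim: k => [|k IH] f mf f0 fy fE.
  have {fE}/choice[E EP] i : exists A, <<s G i >> A /\ f i = \1_A.
    by have [A ? ?] := fE i isT; exists A.
  transitivity (\int[P]_x (\1_(\bigcap_(i in [set: 'I_n]) E i) x)%:E)%E.
    apply: eq_integral => x _; congr (_%:E).
    rewrite indicE; have [xE|xE] := boolP (x \in _).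
      rewrite big1// => i _; rewrite (EP i).2 indicE mem_set//.
      by move/set_mem: xE; exact.
    have [i Ei] : exists i, ~ E i x.
      apply/existsNP => Ex; move/negP: xE; apply.
      by apply/mem_set => i _; exact: Ex.
    by rewrite (bigD1 i)//= (EP i).2 indicE memNset// mul0r.
  rewrite integral_indic//; last first.
    by apply: fin_bigcap_measurable => // i _; exact: sGm (EP i).1.
  rewrite setIT; etransitivity; first by apply: indP => i; exact: (EP i).1.
  apply: eq_bigr => i _; rewrite (EP i).2 integral_indic ?setIT//.
  exact: sGm (EP i).1.
have [kn|nk] := ltnP k n; last first.
  by apply: IH => // i ki; move: (ltn_ord i); rewrite ltnNge (leq_trans nk).
pose i0 := Ordinal kn.
have fin i : (\int[P]_x (f i x)%:E \is a fin_num)%E.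
  by rewrite ge0_fin_numE// integral_ge0// => x _; rewrite lee_fin.
rewrite (bigD1 i0)//=.
have -> : (\prod_(i < n | i != i0) \int[P]_x (f i x)%:E =
    (\prod_(i < n | i != i0) fine (\int[P]_x (f i x)%:E))%:E)%E.
  by rewrite -prodEFin; apply: eq_bigr => i _; rewrite fineK.
under eq_integral do rewrite (bigD1 i0)//=.
apply: (@integral_sigma_ext (G i0)) => //.
- under eq_fun do rewrite big_mkcond/=.
  apply: measurable_prod => i _; case: (i != i0) => //=.
  exact: measurable_fun_g_sigma (mf i).
- by move=> x; exact: prodr_ge0.
- apply: prodr_ge0 => i _; rewrite fine_ge0// integral_ge0// => x _.
  by rewrite lee_fin.
move=> A GA.
(* Putting an indicator in place of factor [i0] leaves at most [k] factors that need not be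
   indicators, which is the case covered by [IH]. *)
pose f' i := if i == i0 then \1_A else f i.
have f'E i : i != i0 -> f' i = f i by rewrite /f' => /negPf->.
have f'0 : f' i0 = \1_A by rewrite /f' eqxx.
have -> : (\int[P]_x (\1_A x * \prod_(i < n | i != i0) f i x)%:E =
    \int[P]_x (\prod_(i < n) f' i x)%:E)%E.
  apply: eq_integral => x _; rewrite [in RHS](bigD1 i0)//= f'0.
  by congr (_ * _)%:E; apply: eq_bigr => i /f'E ->.
have mA : measurable A := sGm _ _ GA.
have intA : (\int[P]_x (\1_A x)%:E = P A)%E by rewrite integral_indic ?setIT.
rewrite IH.
- rewrite (bigD1 i0)//= f'0 intA -prodEFin; congr (_ * _)%E.
  by apply: eq_bigr => i /f'E ->; rewrite fineK.
- move=> i; have [->|/f'E->//] := eqVneq i i0; rewrite f'0.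
  exact: measurable_indic.
- move=> i x; have [->|/f'E->//] := eqVneq i i0; rewrite f'0.
  by rewrite indicE.
- move=> i; have [->|/f'E->//] := eqVneq i i0; rewrite f'0 intA.
  by rewrite (le_lt_trans (probability_le1 _ _))// ltry.
- move=> i; rewrite leq_eqVlt => /predU1P[ki|ki].
    have -> : i = i0 by apply/val_inj.
    by exists A.
  rewrite f'E; first exact: fE.
  by apply: contraTneq ki => ->; rewrite ltnn.
Qed.

End Independence.

(** * Quadratic bounds on the exponential and the choice of parameters *)

Section Scalar.
Context {R : realType}.
Implicit Types t u : R.

(** From [1 - t <= expR (- t)] follows [(1 - t) * expR t <= 1], while
    [(1 - t) * (1 + t + 2 * t ^+ 2)] exceeds 1 by [t ^+ 2 * (1 - 2 * t)]. Large negative [t] is thus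
    allowed. *)
Lemma expR_le_quad_small t : t <= 2^-1 -> expR t <= 1 + t + 2 * t ^+ 2.
Proof.
move=> t2; have := expR_ge1Dx (- t); rewrite expRN => h.
have et := expR_gt0 t.
have h1 : (1 - t) * expR t <= 1.
  by rewrite -ler_pdivlMr// div1r.
have : (1 - t) * expR t <= (1 - t) * (1 + t + 2 * t ^+ 2).
  apply: (le_trans h1); rewrite -subr_ge0.
  rewrite (_ : _ - 1 = t ^+ 2 * (1 - 2 * t)); last by ring.
  by rewrite mulr_ge0 ?sqr_ge0//; lra.
by rewrite ler_pM2l//; lra.
Qed.

Lemma expR_ge_sqr u : 0 <= u -> (1 + u / 2) ^+ 2 <= expR u.
Proof.
move=> u0; rewrite {2}(_ : u = u / 2 + u / 2); last by field.
by rewrite expRD -expr2 lerXn2r// ?nnegrE ?expR_ge0 ?expR_ge1Dx//; lra.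
Qed.

(** Beyond 1/2 one has [1 <= 4 * t ^+ 2], so the quadratic term alone dominates [expR u]. *)
Lemma expR_le_quad u t : 0 <= u -> t <= u ->
  expR t <= 1 + t + 4 * expR u * t ^+ 2.
Proof.
move=> u0 tu; have e1 : 1 <= expR u by rewrite -expR0 ler_expR.
have t2 := sqr_ge0 t.
have [th|th] := leP t 2^-1.
  by have := expR_le_quad_small _ th; nra.
have : expR t <= expR u by rewrite ler_expR.
by have : 2^-1 * 2^-1 <= t ^+ 2; nra.
Qed.

(** The gain [u ^- 2] is what the second regime needs. For [t] in [[1/2, u]],
    [u <= 4 * t * (1 + (u - t) / 2)], and the square of the last factor is at most [expR (u - t)].
    For smaller [t], [expR u / u ^+ 2] is at least 1/4. *)
Lemma expR_le_quad_large u t : 1 <= u -> t <= u ->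
  expR t <= 1 + t + 16 * (expR u / u ^+ 2) * t ^+ 2.
Proof.
move=> u1 tu; have t2 := sqr_ge0 t.
have u2 : 0 < u ^+ 2 by rewrite exprn_gt0//; lra.
have [th|th] := leP t 2^-1.
  have := expR_le_quad_small _ th.
  have : 4^-1 <= expR u / u ^+ 2.
    rewrite ler_pdivlMr//.
    have := @expR_ge_sqr u; nra.
  nra.
have key : u ^+ 2 * expR t <= 16 * expR u * t ^+ 2.
  have -> : expR u = expR (u - t) * expR t by rewrite -expRD; congr expR; ring.
  have et := expR_gt0 t.
  suff : u ^+ 2 <= 16 * expR (u - t) * t ^+ 2 by nra.
  have ut : 0 <= u - t by lra.
  have h : u ^+ 2 <= 16 * (1 + (u - t) / 2) ^+ 2 * t ^+ 2.
    have : u <= 4 * ((1 + (u - t) / 2) * t) by nra.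
    have : 0 <= u by lra.
    move=> ? ?; rewrite (_ : 16 * _ * _ = (4 * ((1 + (u - t) / 2) * t)) ^+ 2); last by ring.
    by rewrite lerXn2r// nnegrE; nra.
  apply: (le_trans h); rewrite ler_wpM2r// ler_wpM2l//.
  exact: expR_ge_sqr.
have -> : 16 * (expR u / u ^+ 2) * t ^+ 2 = (16 * expR u * t ^+ 2) / u ^+ 2.
  by ring.
have : expR t <= 16 * expR u * t ^+ 2 / u ^+ 2 by rewrite ler_pdivlMr// mulrC.
lra.
Qed.

Lemma powR_expR (x y : R) : powR (expR x) y = expR (x * y).
Proof. by rewrite -expRM. Qed.

Lemma Ustar_parameters (q sigma B : R) (p n : nat) :
  2 < q -> (0 < n)%N -> (0 < p)%N -> 0 < sigma -> 0 < B ->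
  exists lam M kap, [/\ 0 < lam, 0 < M, 0 <= kap,
    forall t, t <= lam * M -> expR t <= 1 + t + kap * t ^+ 2 &
    3 * (ln (2 * p%:R) / n%:R) / lam + 2 * (powR M (1 - q) * powR B q)
      + kap * lam * sigma ^+ 2
    <= (21 + 4 * expR (expR 1)) * Ustar q sigma B p n].
Proof.
move=> q2 n0 p0 sigma0 B0; rewrite /Ustar.
set L := ln _ / _.
have L0 : 0 < L.
  rewrite divr_gt0 ?ltr0n// ln_gt0// -natrM ltr1n.
  by case: (p) p0 => // k _; rewrite mulnS.
(* With [L], [sigma] and [B] written as exponentials of [l], [s] and [b], products and powers become
   identities and inequalities linear in these logarithms. *)
have -> : L = expR (ln L) by rewrite lnK.
have -> : sigma = expR (ln sigma) by rewrite lnK.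
have -> : B = expR (ln B) by rewrite lnK.
move: (ln L) (ln sigma) (ln B) => l s b {L L0 sigma sigma0 B B0}.
have q0 : q != 0 by lra.
have q20 : q - 2 != 0 by lra.
have -> : expR b ^+ 2 / expR s ^+ 2 = expR (2 * b - 2 * s).
  by rewrite -!expRM_natr -expRB; congr expR; ring.
rewrite !powR_expR -!expRD expRK ler_expR.
have Cge : 0 < expR (expR 1) :> R by exact: expR_gt0.
case: ifPn => [cA|/negbTE cB].
  (* [lam = sqrt L / sigma] and [M = e sigma / sqrt L] *)
  exists (expR (l / 2 - s)), (expR (1 + s - l / 2)), (4 * expR (expR 1)); split.
  - exact: expR_gt0.
  - exact: expR_gt0.
  - by rewrite mulr_ge0// expR_ge0.
  - move=> t; rewrite -expRD (_ : l / 2 - s + _ = 1); last by ring.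
    by apply: expR_le_quad; exact: expR_ge0.
  have -> : Num.sqrt (expR l) = expR (l / 2).
    rewrite (_ : expR l = expR (l / 2) ^+ 2) ?sqrtr_sqr ?ger0_norm ?expR_ge0//.
    by rewrite -expRM_natr; congr expR; field.
  move: (expR (expR 1)) Cge => c c0.
  rewrite -!expRM_natr !powR_expR -!mulrA -!expRB -!expRD.
  set U := expR (s + l / 2).
  have -> : expR (l - (l / 2 - s)) = U by congr expR; field.
  have -> : expR (l / 2 - s + s * 2%:R) = U by congr expR; ring.
  (* The difference of the two exponents is [q / 2] plus [(q - 2) / 2] times the slack in the
     condition [cA] of the first regime. *)
  have : expR ((1 + s - l / 2) * (1 - q) + b * q) <= U.
    rewrite ler_expR -subr_ge0.
    have : 0 <= (q - 2) / 2 * (1 - ((2 * b - 2 * s) * (q / (q - 2)) + l)).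
      by rewrite mulr_ge0//; lra.
    rewrite (_ : (q - 2) / 2 * _ = (q - 2) / 2 - (q * (b - s) + (q - 2) / 2 * l)); last by field.
    lra.
  have U0 : 0 < U by exact: expR_gt0.
  nra.
set ell := 2 * b - 2 * s + l * (1 - 2 / q).
(* [ell] is [(q - 2) / q] times a quantity that exceeds 1 in this regime. It is positive, but it may
   be below 1 when [q] is close to 2. *)
have ell0 : 0 < ell.
  move: cB => /negbT; rewrite -ltNge => cB.
  rewrite /ell (_ : _ + _ = (q - 2) / q * ((2 * b - 2 * s) * (q / (q - 2)) + l)).
    by rewrite mulr_gt0 ?divr_gt0//; lra.
  by field; rewrite q0 q20.
have ellE : ell = expR (ln ell) by rewrite lnK.
set m := ln ell in ellE.
rewrite [X in powR X _]ellE powR_expR -expRD.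
set U := expR (b + _ + _).
have U0 : 0 < U by exact: expR_gt0.
(* [lam = L / U] and [M = B (ell / L)^(1/q)] *)
pose lam := expR (- b + l / q + m * (1 - q^-1)).
pose M := expR (b + (m - l) / q).
have lamM : lam * M = ell.
  by rewrite /lam /M -expRD ellE; congr expR; field.
have T1 : expR l / lam = U by rewrite -expRB; congr expR; field.
have T2 : powR M (1 - q) * expR (b * q) = U.
  by rewrite powR_expR -expRD; congr expR; field.
(* The variance term carries the excess factor [ell] to the power [2 - 2 / q]. *)
have T3 : expR ell * (lam * expR s ^+ 2) = U * expR (m * (2 - 2 / q)).
  by rewrite -expRM_natr -!expRD /ell; congr expR; field.
have q1 : 0 <= q^-1 by rewrite invr_ge0; lra.
have q1' : q^-1 <= 2^-1 by rewrite lef_pV2 ?posrE; lra.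
(* For [ell <= 1] the excess factor is at most 1 and [kap = 4 * expR ell] suffices. For [ell > 1]
   the division by [ell ^+ 2] in [kap] reduces it to [ell] to the power [- 2 / q], again at most 1;
   the total is then 3 + 2 + 16 = 21 times [U]. *)
have [m0|m0] := leP m 0.
  exists lam, M, (4 * expR ell); split; try exact: expR_gt0.
  - by rewrite mulr_ge0// expR_ge0.
  - by move=> t; rewrite lamM; apply: expR_le_quad; exact: ltW.
  rewrite -!mulrA T1 T2 T3.
  have : expR (m * (2 - 2 / q)) <= 1.
    by rewrite -[leRHS]expR0 ler_expR mulr_le0_ge0//; lra.
  nra.
exists lam, M, (16 * (expR ell / ell ^+ 2)); split; try exact: expR_gt0.
- by rewrite mulr_ge0// divr_ge0 ?expR_ge0 ?sqr_ge0.
- move=> t; rewrite lamM; apply: expR_le_quad_large.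
  by rewrite ellE -expR0 ler_expR ltW.
have -> : 16 * (expR ell / ell ^+ 2) * lam * expR s ^+ 2 =
   16 * ((expR ell * (lam * expR s ^+ 2)) / ell ^+ 2) by ring.
have -> : expR ell * (lam * expR s ^+ 2) / ell ^+ 2 = U * expR (m * (- 2 / q)).
  rewrite T3 [in ell ^+ 2]ellE -expRM_natr -mulrA -expRB; congr (_ * expR _); ring.
rewrite -mulrA T1 T2.
have : expR (m * (- 2 / q)) <= 1.
  by rewrite -[leRHS]expR0 ler_expR mulr_ge0_le0//; lra.
nra.
Qed.

End Scalar.

(** * Measurability of finite maxima and calculus of expectation bounds *)

Lemma measurable_bigmaxr {R : realType} {d} {T : measurableType d} (I : Type)
    (s : seq I) (h : I -> T -> R) :
  (forall i, measurable_fun setT (h i)) ->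
  measurable_fun setT (fun x => \big[Order.max/0]_(i <- s) h i x).
Proof.
move=> mh; elim: s => [|i s IH].
  by under eq_fun do rewrite big_nil; exact: measurable_cst.
by under eq_fun do rewrite big_cons; exact: measurable_maxr.
Qed.

(** Bundling measurability and nonnegativity with a real bound lets upper bounds be added, scaled
    and compared without separate integrability arguments. *)
Definition expectation_le {R : realType} {d} {T : measurableType d}
    (P : probability T R) (f : T -> R) (r : R) :=
  [/\ measurable_fun setT f, forall x, 0 <= f x &
      (\int[P]_x (f x)%:E <= r%:E)%E].

Section ExpectationLe.
Context {R : realType} {d : measure_display} {T : measurableType d}
  (P : probability T R).
Implicit Types (f g : T -> R) (r s c : R).

Lemma expectation_le_cst c : 0 <= c -> expectation_le P (fun=> c) c.
Proof.
move=> c0; split => //.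
rewrite [leLHS](integral_cst P measurableT).
rewrite [X in (_ * X)%E](_ : _ = 1%E) ?mule1//; exact: probability_setT.
Qed.

Lemma expectation_leD f g r s : expectation_le P f r -> expectation_le P g s ->
  expectation_le P (fun x => f x + g x) (r + s).
Proof.
move=> [mf f0 fr] [mg g0 gs]; split.
- exact: measurable_funD.
- by move=> x; rewrite addr_ge0.
under eq_integral do rewrite EFinD.
rewrite ge0_integralD//; [by rewrite EFinD leeD| |..].
all: by [move=> x _; rewrite lee_fin|exact/measurable_EFinP].
Qed.

Lemma expectation_leZ c f r : 0 <= c -> expectation_le P f r ->
  expectation_le P (fun x => c * f x) (c * r).
Proof.
move=> c0 [mf f0 fr]; split.
- exact: measurable_funM.
- by move=> x; rewrite mulr_ge0.
under eq_integral do rewrite EFinM.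
rewrite ge0_integralZl_EFin//; [by rewrite EFinM lee_wpmul2l| |..].
all: by [move=> x _; rewrite lee_fin|exact/measurable_EFinP].
Qed.

Lemma expectation_le_sum (I : Type) (l : seq I) (f : I -> T -> R) (r : I -> R) :
  (forall i, expectation_le P (f i) (r i)) ->
  expectation_le P (fun x => \sum_(i <- l) f i x) (\sum_(i <- l) r i).
Proof.
move=> fr; elim: l => [|i l IH].
  under eq_fun do rewrite big_nil; rewrite big_nil.
  exact: expectation_le_cst.
under eq_fun do rewrite big_cons; rewrite big_cons.
exact: expectation_leD.
Qed.

Lemma le_expectation_le f g r s : measurable_fun setT f ->
  (forall x, 0 <= f x <= g x) -> r <= s -> expectation_le P g r ->
  expectation_le P f s.
Proof.
move=> mf fg rs [mg g0 gr]; split => //.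
  by move=> x; have /andP[] := fg x.
apply: (@le_trans _ _ r%:E); last by rewrite lee_fin.
apply: le_trans gr; apply: ge0_le_integral => //.
- by move=> x _; rewrite lee_fin; have /andP[] := fg x.
- exact/measurable_EFinP.
- exact/measurable_EFinP.
- by move=> x _; rewrite lee_fin; have /andP[] := fg x.
Qed.

(* Only the sum is assumed nonnegative, so a centered [f] may change sign. *)
Lemma expectation_leD_centered f h r :
  P.-integrable setT (EFin \o f) -> (\int[P]_x (f x)%:E = 0)%E ->
  (forall x, 0 <= f x + h x) -> expectation_le P h r ->
  expectation_le P (fun x => f x + h x) r.
Proof.
move=> fi f0 fh [mh h0 hr].
have mf : measurable_fun setT f by case/integrableP: fi => /measurable_EFinP.
split => //; first exact: measurable_funD.
under eq_integral do rewrite EFinD.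
rewrite integralD//; first by rewrite f0 add0e.
apply/integrableP; split; first exact/measurable_EFinP.
under eq_integral do rewrite /= ger0_norm//.
by apply: (le_lt_trans hr); rewrite ltry.
Qed.

End ExpectationLe.

(** * Pointwise estimates for truncation *)

Section Truncation.
Context {R : realType}.
Implicit Types (N M y q : R).

(** Pointwise Markov: [N] is multiplied by [N / M] to the power [q - 1], which is at least 1. *)
Lemma le_powR_tail M N q : 1 < q -> 0 < M -> M < N ->
  N <= powR M (1 - q) * powR N q.
Proof.
move=> q1 M0 MN; have N0 : 0 < N by lra.
rewrite -[M]lnK ?posrE// -[N]lnK ?posrE// !powR_expR -expRD ler_expR.
have : ln M < ln N by rewrite ltr_ln ?posrE.
nra.
Qed.

Lemma truncation_error q M N y : 1 < q -> 0 < M -> `|y| <= N ->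
  `|y - (if N <= M then y else 0)| <= powR M (1 - q) * powR N q.
Proof.
move=> q1 M0 yN; case: ifPn => [_|].
  by rewrite subrr normr0 mulr_ge0 ?powR_ge0.
rewrite -ltNge subr0 => MN.
exact: (le_trans yN (le_powR_tail _ _ _ q1 M0 MN)).
Qed.

(** Truncation destroys centering, so the linear term keeps the original [y], whose expectation
    vanishes. When [y] is discarded the left side is 1, and a negative [lam * y] is compensated by
    the tail term. *)
Lemma expR_truncation q M N y lam kap :
  1 < q -> 0 < M -> `|y| <= N -> 0 < lam -> 0 <= kap ->
  (forall t, t <= lam * M -> expR t <= 1 + t + kap * t ^+ 2) ->
  expR (lam * (if N <= M then y else 0)) <=
  lam * y + (1 + lam * (powR M (1 - q) * powR N q) + kap * lam ^+ 2 * y ^+ 2).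
Proof.
move=> q1 M0 yN lam0 kap0 h.
have t0 : 0 <= kap * lam ^+ 2 * y ^+ 2 by rewrite mulr_ge0 ?sqr_ge0// mulr_ge0 ?sqr_ge0.
have := truncation_error q M N y q1 M0 yN.
case: ifPn => [NM _|_].
  have g0 : 0 <= lam * (powR M (1 - q) * powR N q).
    by rewrite !mulr_ge0 ?powR_ge0// ltW.
  have /h : lam * y <= lam * M.
    by rewrite ler_pM2l// (le_trans (ler_norm _))// (le_trans yN).
  by rewrite exprMn; lra.
rewrite subr0 mulr0 expR0 => yg.
have : - y <= powR M (1 - q) * powR N q.
  by rewrite (le_trans _ yg)// -normrN ler_norm.
nra.
Qed.

End Truncation.

(** * Sup norm and truncated vectors *)

Section SupNorm.
Context {R : realType} {p : nat}.

Definition sup_norm {T : Type} (Y : 'I_p -> T -> R) (x : T) : R :=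
  \big[Order.max/0]_(j < p) `|Y j x|.

Lemma sup_norm_ge0 {T : Type} (Y : 'I_p -> T -> R) x : 0 <= sup_norm Y x.
Proof. exact: bigmax_ge_id. Qed.

Lemma ler_sup_norm {T : Type} (Y : 'I_p -> T -> R) j x : `|Y j x| <= sup_norm Y x.
Proof. exact: (le_bigmax _ (fun j => `|Y j x|)). Qed.

Lemma measurable_sup_norm {d} {T : measurableType d} (Y : 'I_p -> T -> R) :
  (forall j, measurable_fun setT (Y j)) -> measurable_fun setT (sup_norm Y).
Proof. by move=> mY; apply: measurable_bigmaxr => j; exact: measurableT_comp. Qed.

(** All coordinates are discarded together, according to the sup norm, so a single tail term,
    controlled by the [q]-th moment of that norm, serves every coordinate. *)
Definition truncation {T : Type} (M : R) (Y : 'I_p -> T -> R) (j : 'I_p) (x : T) : R :=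
  if sup_norm Y x <= M then Y j x else 0.

Lemma measurable_truncation {d} {T : measurableType d} M (Y : 'I_p -> T -> R) j :
  (forall j, measurable_fun setT (Y j)) -> measurable_fun setT (truncation M Y j).
Proof.
move=> mY; apply: measurable_fun_ifT => //.
by apply: measurable_fun_ler => //; exact: measurable_sup_norm.
Qed.

Lemma measurable_gen_sigma {d} {T : measurableType d} (Y : 'I_p -> T -> R) j :
  measurable_fun (setT : set (g_sigma_algebraType
    [set E : set T | exists j A, measurable A /\ E = Y j @^-1` A])) (Y j).
Proof.
move=> _ A mA; apply: sub_sigma_algebra; rewrite setTI.
by exists j, A.
Qed.

End SupNorm.

(** * Moment bound, exponential moments and union bound *)

Section MaximalInequality.
Context {R : realType} {d : measure_display} {T : measurableType d}
  (P : probability T R) (n p : nat) (X : 'I_n -> 'I_p -> T -> R).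
Variables (q sigma B : R).
Hypotheses (n0 : (0 < n)%N) (p0 : (0 < p)%N) (q1 : 1 < q) (B0 : 0 < B).
Hypothesis mX : forall i j, measurable_fun setT (X i j).
Hypothesis indX : indep_vectors P X.
Hypothesis X0 : forall i j, P.-integrable setT (fun x => (X i j x)%:E) /\
                   (\int[P]_x (X i j x)%:E = 0)%E.
Hypothesis varX : (Vvar P X <= (sigma ^+ 2)%:E)%E.
Hypothesis momX : (Dq P q X <= B%:E)%E.

Let nR : 0 < n%:R :> R. Proof. by rewrite ltr0n. Qed.

(** Passes from a bound on the average of extended-real integrals to real bounds for each index;
    nonnegativity forces each integral to be finite. *)
Lemma expectation_le_fine (f : 'I_n -> T -> R) (r : R) :
  (forall i, measurable_fun setT (f i)) -> (forall i x, 0 <= f i x) ->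
  ((n%:R)^-1%:E * \sum_(i < n) \int[P]_x (f i x)%:E <= r%:E)%E ->
  exists2 s : 'I_n -> R, forall i, expectation_le P (f i) (s i) &
    \sum_(i < n) s i <= n%:R * r.
Proof.
move=> mf f0 fr.
have int0 i : (0 <= \int[P]_x (f i x)%:E)%E.
  by apply: integral_ge0 => x _; rewrite lee_fin.
have sum_le : (\sum_(i < n) \int[P]_x (f i x)%:E <= (n%:R * r)%:E)%E.
  by rewrite EFinM -lee_pdivrMl.
have fin i : (\int[P]_x (f i x)%:E \is a fin_num)%E.
  rewrite ge0_fin_numE// (le_lt_trans _ (ltry (n%:R * r)))// (le_trans _ sum_le)//.
  by rewrite (bigD1 i)//= leeDl// sume_ge0.
exists (fun i => fine (\int[P]_x (f i x)%:E)) => [i|].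
  by split => //; rewrite fineK.
rewrite -lee_fin -sumEFin; apply: le_trans sum_le.
by apply: lee_sum => i _; rewrite fineK.
Qed.

Lemma moment_bounds : exists2 b : 'I_n -> R,
  forall i, expectation_le P (fun x => powR (sup_norm (X i) x) q) (b i) &
  \sum_(i < n) b i <= n%:R * powR B q.
Proof.
apply: expectation_le_fine => //.
- move=> i; apply: (@measurableT_comp _ _ _ _ _ _ (fun y : R => powR y q)).
    exact: measurable_powR.
  exact: measurable_sup_norm.
- by move=> i x; exact: powR_ge0.
have q0 : 0 < q := lt_trans ltr01 q1.
move: momX; rewrite /Dq; set a := (_ * _)%E => aB.
have a0 : (0 <= a)%E.
  rewrite mule_ge0 ?lee_fin ?invr_ge0// sume_ge0// => i _.
  by apply: integral_ge0 => x _; rewrite lee_fin powR_ge0.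
(* An infinite average moment is impossible, since its power [q^-1] would be infinite too. *)
case: a aB a0 => [a| |]//=; last by rewrite invr_eq0 gt_eqF.
rewrite !lee_fin => aB a0.
rewrite -[a]powRr1// -[X in powR a X](@mulVf _ q) ?gt_eqF// powRrM.
by apply: ge0_ler_powR => //; rewrite ?nnegrE ?powR_ge0// ltW.
Qed.

Lemma variance_bounds j : exists2 s : 'I_n -> R,
  forall i, expectation_le P (fun x => X i j x ^+ 2) (s i) &
  \sum_(i < n) s i <= n%:R * sigma ^+ 2.
Proof.
apply: expectation_le_fine => //.
- by move=> i; exact: measurable_funX.
- by move=> i x; exact: sqr_ge0.
apply: le_trans varX; rewrite /Vvar.
exact: (le_bigmax _ (fun j => ((n%:R)^-1%:E * \sum_(i < n) \int[P]_x ((X i j x) ^+ 2)%:E)%E)).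
Qed.

(** Supplies the entry [B] of the minimum. Each sup norm is at most [B] plus its tail term at level
    [B], and the tail terms average to at most [B] in expectation. *)
Lemma Emax_le_moment : (Emax P X <= (2 * B)%:E)%E.
Proof.
have [b hb bB] := moment_bounds.
have BB : powR B (1 - q) * powR B q = B.
  by rewrite -powRD ?subrK ?powRr1 ?oner_eq0// ltW.
pose rhs x := n%:R^-1 * \sum_(i < n) (B + powR B (1 - q) * powR (sup_norm (X i) x) q).
have hrhs : expectation_le P rhs
    (n%:R^-1 * \sum_(i < n) (B + powR B (1 - q) * b i)).
  apply: expectation_leZ; first by rewrite invr_ge0.
  apply: expectation_le_sum => i.
  apply: expectation_leD; first by apply: expectation_le_cst; exact: ltW.
  by apply: expectation_leZ => //; exact: powR_ge0.
have young x i : sup_norm (X i) x <= B + powR B (1 - q) * powR (sup_norm (X i) x) q.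
  have [NB|BN] := leP (sup_norm (X i) x) B.
    by rewrite (le_trans NB)// lerDl mulr_ge0// powR_ge0.
  by rewrite (le_trans (le_powR_tail _ _ _ q1 B0 BN))// lerDr ltW.
rewrite /Emax; have [] // := @le_expectation_le _ _ _ P
  (fun x => \big[Order.max/0]_(j < p) `|n%:R^-1 * \sum_(i < n) X i j x|)
  rhs _ (2 * B) _ _ _ hrhs.
- apply: measurable_bigmaxr => j; apply: measurableT_comp => //.
  by apply: measurable_funM => //; exact: measurable_sum.
- move=> x; rewrite bigmax_ge_id; apply: bigmax_le => [|j _].
    rewrite mulr_ge0 ?invr_ge0// sumr_ge0// => i _.
    exact: le_trans (sup_norm_ge0 _ _) (young x i).
  rewrite normrM gtr0_norm ?invr_gt0// ler_pM2l ?invr_gt0//.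
  apply: (le_trans (ler_norm_sum _ _ _)); apply: ler_sum => i _.
  exact: le_trans (ler_sup_norm _ _ _) (young x i).
rewrite ler_pdivrMl// big_split/= sumr_const card_ord -mulr_sumr.
rewrite [leRHS](_ : _ = B *+ n + n%:R * B); last by ring.
rewrite lerD2l.
apply: (@le_trans _ _ (powR B (1 - q) * (n%:R * powR B q))).
  by rewrite ler_wpM2l// powR_ge0.
by rewrite mulrCA BB.
Qed.

Variables (lam M kap : R).
Hypotheses (lam0 : 0 < lam) (M0 : 0 < M) (kap0 : 0 <= kap).
Hypothesis kapP : forall t, t <= lam * M -> expR t <= 1 + t + kap * t ^+ 2.

Let G := powR M (1 - q).

(** Integrating [expR_truncation] removes the linear term by centering, and [1 + x <= expR x] gives
    a form that multiplies over [i]. The sign [e] serves both sides of the absolute value. *)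
Lemma mgf_truncation (e : R) i j b s : `|e| = 1 ->
  expectation_le P (fun x => powR (sup_norm (X i) x) q) b ->
  expectation_le P (fun x => X i j x ^+ 2) s ->
  expectation_le P (fun x => expR (lam * (e * truncation M (X i) j x)))
    (expR (lam * (G * b) + kap * lam ^+ 2 * s)).
Proof.
move=> e1 hb hs.
have e2 : e ^+ 2 = 1 by rewrite -real_normK ?num_real// e1 expr1n.
have pt x : expR (lam * (e * truncation M (X i) j x)) <=
    lam * e * X i j x + (1 + lam * (G * powR (sup_norm (X i) x) q)
      + kap * lam ^+ 2 * X i j x ^+ 2).
  rewrite /truncation (fun_if (fun y => e * y)) mulr0 -mulrA.
  have -> : X i j x ^+ 2 = (e * X i j x) ^+ 2 by rewrite exprMn e2 mul1r.
  apply: expR_truncation => //.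
  by rewrite normrM e1 mul1r ler_sup_norm.
apply: (@le_expectation_le _ _ _ P _ _ (1 + lam * (G * b) + kap * lam ^+ 2 * s)).
- apply: measurableT_comp => //; apply: measurable_funM => //.
  by apply: measurable_funM => //; exact: measurable_truncation.
- by move=> x; rewrite expR_ge0; exact: pt.
- by rewrite -addrA; exact: expR_ge1Dx.
have [iX zX] := X0 i j.
apply: expectation_leD_centered.
- have := integrableZl measurableT (lam * e) iX.
  by under eq_fun do rewrite -EFinM.
- under eq_integral do rewrite EFinM.
  by rewrite integralZl// zX mule0.
- by move=> x; apply: le_trans (pt x); exact: expR_ge0.
apply: expectation_leD.
  apply: expectation_leD; first exact: expectation_le_cst.
  apply: expectation_leZ; first exact: ltW.
  by apply: expectation_leZ => //; exact: powR_ge0.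
by apply: expectation_leZ => //; rewrite mulr_ge0 ?sqr_ge0.
Qed.

Lemma mgf_sum_truncation (e : R) j : `|e| = 1 ->
  expectation_le P (fun x => expR (lam * (e * \sum_(i < n) truncation M (X i) j x)))
    (expR (n%:R * (lam * (G * powR B q) + kap * lam ^+ 2 * sigma ^+ 2))).
Proof.
move=> e1.
have [b hb bB] := moment_bounds.
have [s hs ss] := variance_bounds j.
pose F i x := expR (lam * (e * truncation M (X i) j x)).
have hF i := mgf_truncation e i j _ _ e1 (hb i) (hs i).
(* The truncated coordinate depends on [X i] alone, so it is measurable for the sigma-algebra on
   which independence is assumed. *)
have mgsig i : measurable_fun (setT : set (g_sigma_algebraType
    [set E : set T | exists j A, measurable A /\ E = X i j @^-1` A])) (F i).
  apply: measurableT_comp => //; apply: measurable_funM => //.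
  apply: measurable_funM => //; apply: measurable_truncation => k.
  exact: measurable_gen_sigma.
have FE x : expR (lam * (e * \sum_(i < n) truncation M (X i) j x)) =
    \prod_(i < n) F i x.
  by rewrite !mulr_sumr expR_sum.
split.
- apply: measurableT_comp => //; apply: measurable_funM => //.
  apply: measurable_funM => //; apply: measurable_sum => i.
  exact: measurable_truncation.
- by move=> x; exact: expR_ge0.
under eq_integral do rewrite FE.
rewrite (@integral_prod_indep _ _ _ P n
  (fun i => [set E : set T | exists j A, measurable A /\ E = X i j @^-1` A])) //.
- apply: (@le_trans _ _ (\prod_(i < n) (expR (lam * (G * b i) + kap * lam ^+ 2 * s i))%:E)%E).
    (* Multiplying inequalities in the extended reals requires nonnegative factors, so the induction
       carries both facts. *)
    pose le0 (u v : \bar R) := (0 <= u)%E /\ (u <= v)%E.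
    apply: proj2 (_ : le0 _ _); rewrite /le0.
    elim/big_ind2 : _ => [|x1 x2 y1 y2 [? ?] [? ?]|i _].
    - by rewrite lee_fin ler01.
    - by rewrite mule_ge0 ?lee_pmul.
    - have [_ _ ->] := hF i; split => //.
      by apply: integral_ge0 => x _; rewrite lee_fin expR_ge0.
  rewrite prodEFin -expR_sum lee_fin ler_expR big_split/= -!mulr_sumr.
  rewrite mulrDr; apply: lerD.
    by rewrite [leRHS]mulrCA ler_pM2l// [leRHS]mulrCA ler_wpM2l// powR_ge0.
  by rewrite [leRHS]mulrCA ler_wpM2l// mulr_ge0 ?sqr_ge0.
- move=> i E [k [A [mA ->]]]; rewrite -[X in measurable X]setTI.
  exact: mX.
- by move=> i x; exact: expR_ge0.
- by move=> i; have [_ _ h] := hF i; apply: (le_lt_trans h); rewrite ltry.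
Qed.

(** One tail term [G * powR B q] pays for the discarded part, the other for the lost centering
    inside the exponential moments. *)
Lemma maximal_inequality :
  (Emax P X <= (3 * (ln (2 * p%:R) / n%:R) / lam + 2 * (G * powR B q)
      + kap * lam * sigma ^+ 2)%:E)%E.
Proof.
have [b hb bB] := moment_bounds.
pose v := n%:R * (lam * (G * powR B q) + kap * lam ^+ 2 * sigma ^+ 2).
(* This [a] makes [expR (- a)] times the bound [expR v] summed over the [2p] signed coordinates
   equal to 1. *)
pose a := ln (2 * p%:R) + v.
have p2 : 1 <= p%:R :> R by rewrite ler1n.
(* The quadratic bound at 1/2 gives [expR 2^-1 <= 2]. The additive 1 left by the tangent line is
   then absorbed into [2 * ln (2 * p%:R)], whence the factor 3. *)
have ln2p : 1 <= 2 * ln (2 * p%:R) :> R.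
  have : 2^-1 <= ln (2 * p%:R) :> R.
    rewrite -ler_expR lnK ?posrE; last lra.
    have := expR_le_quad_small (2^-1 : R) (lexx _).
    by rewrite exprVn => h; apply: (le_trans h); lra.
  lra.
have G0 : 0 <= G by exact: powR_ge0.
have v0 : 0 <= v.
  rewrite mulr_ge0// addr_ge0//; first by rewrite !mulr_ge0 ?powR_ge0// ltW.
  by rewrite mulr_ge0 ?sqr_ge0// mulr_ge0 ?sqr_ge0.
have a0 : 0 <= a by rewrite addr_ge0//; lra.
pose S e j x := expR (lam * (e * \sum_(i < n) truncation M (X i) j x)).
pose tail x := \sum_(i < n) G * powR (sup_norm (X i) x) q.
pose rhs x := n%:R^-1 * (tail x + lam^-1 * (a + expR (- a) *
   \sum_(j < p) (S 1 j x + S (-1) j x))).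
have S0 e j x : 0 <= S e j x by exact: expR_ge0.
have tail0 x : 0 <= tail x.
  by apply: sumr_ge0 => i _; rewrite mulr_ge0// powR_ge0.
have sumS0 x : 0 <= \sum_(j < p) (S 1 j x + S (-1) j x).
  by apply: sumr_ge0 => j _; rewrite addr_ge0.
(* Tangent line of [expR] at [a]; it replaces Jensen's inequality for [ln]. *)
have linS e j x : `|e| = 1 -> e * \sum_(i < n) truncation M (X i) j x <=
    lam^-1 * (a + expR (- a) * S e j x).
  move=> e1; rewrite ler_pdivlMl//.
  have := expR_ge1Dx (lam * (e * \sum_(i < n) truncation M (X i) j x) - a).
  by rewrite expRD [_ * expR (- a)]mulrC /S; lra.
have rhs0 x : 0 <= rhs x.
  rewrite mulr_ge0 ?invr_ge0// addr_ge0// mulr_ge0 ?invr_ge0 ?(ltW lam0)//.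
  by rewrite addr_ge0// mulr_ge0 ?expR_ge0.
have pt x : \big[Order.max/0]_(j < p) `|n%:R^-1 * \sum_(i < n) X i j x| <= rhs x.
  apply: bigmax_le => // j _.
  rewrite normrM gtr0_norm ?invr_gt0// ler_pM2l ?invr_gt0//.
  have -> : \sum_(i < n) X i j x =
      \sum_(i < n) (X i j x - truncation M (X i) j x) +
      \sum_(i < n) truncation M (X i) j x.
    by rewrite -big_split/=; apply: eq_bigr => i _; rewrite subrK.
  apply: (le_trans (ler_normD _ _)); apply: lerD.
    apply: (le_trans (ler_norm_sum _ _ _)); apply: ler_sum => i _.
    by apply: truncation_error => //; exact: ler_sup_norm.
  (* The union bound: one exponential is at most the sum over all signed coordinates. *)
  have Sj e : e = 1 \/ e = -1 -> S e j x <= \sum_(j < p) (S 1 j x + S (-1) j x).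
    move=> ee; rewrite (bigD1 j)//=.
    have : 0 <= \sum_(k < p | k != j) (S 1 k x + S (-1) k x).
      by apply: sumr_ge0 => k _; rewrite addr_ge0.
    have := S0 1 j x; have := S0 (-1) j x.
    by case: ee => ->; lra.
  have mono e : e = 1 \/ e = -1 -> e * \sum_(i < n) truncation M (X i) j x <=
     lam^-1 * (a + expR (- a) * \sum_(j < p) (S 1 j x + S (-1) j x)).
    move=> ee; apply: (le_trans (linS e j x _)).
      by case: ee => ->; rewrite ?normrN normr1.
    by rewrite ler_pM2l ?invr_gt0// lerD2l ler_pM2l ?expR_gt0// Sj.
  rewrite ler_norml; apply/andP; split.
    by have := mono (-1) (or_intror erefl); rewrite mulN1r; lra.
  by have := mono 1 (or_introl erefl); rewrite mul1r.
have hS e j : `|e| = 1 -> expectation_le P (S e j) (expR v).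
  exact: mgf_sum_truncation.
have hrhs : expectation_le P rhs (n%:R^-1 * (\sum_(i < n) G * b i +
    lam^-1 * (a + expR (- a) * \sum_(j < p) (expR v + expR v)))).
  apply: expectation_leZ; first by rewrite invr_ge0.
  apply: expectation_leD.
    by apply: expectation_le_sum => i; exact: expectation_leZ.
  apply: expectation_leZ; first by rewrite invr_ge0 ltW.
  apply: expectation_leD; first exact: expectation_le_cst.
  apply: expectation_leZ; first exact: expR_ge0.
  apply: expectation_le_sum => j.
  by apply: expectation_leD; apply: hS; rewrite ?normrN normr1.
rewrite /Emax; have [] // := @le_expectation_le _ _ _ P
  (fun x => \big[Order.max/0]_(j < p) `|n%:R^-1 * \sum_(i < n) X i j x|)
  rhs _ (3 * (ln (2 * p%:R) / n%:R) / lam + 2 * (G * powR B q)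
      + kap * lam * sigma ^+ 2) _ _ _ hrhs.
- apply: measurable_bigmaxr => j; apply: measurableT_comp => //.
  by apply: measurable_funM => //; exact: measurable_sum.
- by move=> x; rewrite pt bigmax_ge_id.
rewrite sumr_const card_ord -mulr_sumr.
have -> : expR (- a) * ((expR v + expR v) *+ p) = 1.
  rewrite /a opprD expRD expRN lnK ?posrE; last lra.
  rewrite expRN -[_ *+ p]mulr_natr; field.
  by rewrite gt_eqF ?expR_gt0//= gt_eqF//; lra.
have : G * \sum_(i < n) b i <= G * (n%:R * powR B q) by rewrite ler_wpM2l.
move=> Gb; rewrite ler_pdivrMl//.
have -> : n%:R * (3 * (ln (2 * p%:R) / n%:R) / lam + 2 * (G * powR B q) +
   kap * lam * sigma ^+ 2) = G * (n%:R * powR B q) + lam^-1 * (2 * ln (2 * p%:R) + a).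
  by rewrite /a /v; field; rewrite !gt_eqF.
apply: lerD => //; rewrite ler_pM2l ?invr_gt0//; lra.
Qed.

End MaximalInequality.

(** * Combination of the two bounds *)

Theorem theorem4p5 (R : realType) :
  exists C : R, 0 < C /\
  forall (q : R) (n p : nat) (sigma B : R),
    2 < q -> (0 < n)%N -> (0 < p)%N -> 0 < sigma -> 0 < B ->
    forall (d : measure_display) (T : measurableType d) (P : probability T R)
      (X : 'I_n -> 'I_p -> T -> R),
      (forall i j, measurable_fun setT (X i j)) ->
      indep_vectors P X ->
      (forall i j, P.-integrable setT (fun x => (X i j x)%:E) /\
                   (\int[P]_x (X i j x)%:E = 0)%E) ->
      (Vvar P X <= (sigma ^+ 2)%:E)%E ->
      (Dq P q X <= B%:E)%E ->
      (Emax P X <= (C * Num.min B (Ustar q sigma B p n))%:E)%E.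
Proof.
have e0 := expR_gt0 (expR 1 : R).
exists (21 + 4 * expR (expR 1)); split; first lra.
move=> q n p sigma B q2 n0 p0 sigma0 B0 d T P X mX indX X0 varX momX.
have q1 : 1 < q by lra.
(* If [B] is the minimum, the bound [2 * B] suffices because the constant exceeds 2. Otherwise the
   maximal inequality is used with the parameters fitted to [Ustar]. *)
have [BU|UB] := leP B (Ustar q sigma B p n).
  apply: (le_trans (Emax_le_moment _ _ _ _ _ _ n0 q1 B0 mX momX)).
  by rewrite lee_fin ler_pM2r//; lra.
have [lam [M [kap [lam0 M0 kap0 kapP le_U]]]] :=
  Ustar_parameters q sigma B p n q2 n0 p0 sigma0 B0.
apply: (le_trans (maximal_inequality _ _ _ _ _ _ _ n0 p0 q1 B0 mX indX X0 varX momX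
  _ _ _ lam0 M0 kap0 kapP)).
by rewrite lee_fin.
Qed.
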